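(* Consider the problem \[ (\mathcal{P}) \quad \text{minimize } f_0(x) = g_0(x) - h_0(x) \quad \text{subject to } F(x) = G(x) - H(x) \preceq_K 0, \quad x \in Q. \] Let the space $Y$ be finite dimensional, the cone $K$ be generating (i.e. $K - K = Y$), and the penalty function $\Phi_c(x) = f_0(x) + c \operatorname{dist}(F(x), -K)$ be bounded below on $Q$ for $c = \min\{ \langle t_0, s \rangle \mid s \in K, \ \|s\| = 1 \} > 0$. Then all limit points of the sequence $\{x_n\}$ generated by the exact penalty DCA (described in the context) are generalized $t_*$-critical points of $(\mathcal{P})$ with $t_* = \lim t_n$. Suppose, in addition, that all points from the set \[ \Big\{ x \in Q \Bigm| \operatorname{dist}(F(x), -K) > \varkappa \Big\} \] are not generalized $\widehat{t}$-critical points with $\widehat{t} = \mu^p t_0$, where $p \in \mathbb{N}$ is the largest natural number satisfying the inequality $\|\mu^p t_0\| \le \tau_{\max}$. Then all limit points $x_*$ of the sequence $\{x_n\}$ satisfy the inequality $\operatorname{dist}(F(x_* ), -K) \le \varkappa$. In particular, if $\varkappa = 0$, then all limit points of the sequence $\{x_n\}$ are feasible and critical for $(\mathcal{P})$.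
   Context: $g_0, h_0 \colon \mathbb{R}^d \to \mathbb{R}$ are real-valued closed convex functions; $\partial$ is the convex subdifferential. $Y$ is a real Banach space with dual $Y^*$, $K \subset Y$ is a proper cone (a closed convex cone with $K \cap (-K) = \{0\}$), $x \preceq_K y$ iff $y - x \in K$, $K^* = \{ y^* \in Y^* \mid \langle y^*, y \rangle \ge 0 \ \forall y \in K \}$; $t \succ_{K^*} 0$ means $t \in K^*$ and $\langle t, y \rangle > 0$ for all $y \in K \setminus \{0\}$. The maps $G, H \colon \mathbb{R}^d \to Y$ are $K$-convex ($G(\alpha x_1 + (1-\alpha)x_2) \preceq_K \alpha G(x_1) + (1-\alpha) G(x_2)$ for all $\alpha \in [0,1]$, $x_1,x_2\in\mathbb{R}^d$; similarly for $H$), $H$ is continuously Fréchet differentiable with derivative $DH$, and $Q \subseteq \mathbb{R}^d$ is a closed convex set. Exact penalty DCA. Initialization: choose $x_0 \in Q$, $t_0 \succ_{K^*} 0$, a maximal norm of the penalty parameter $\tau_{\max} > 0$ (finite), $\mu > 1$, infeasibility tolerance $\varkappa \ge 0$; $n = 0$. Step 1: compute some $v_n \in \partial h_0(x_n)$ and $DH(x_n)$. Step 2: let $(x_{n+1}, s_{n+1})$ be an optimal solution (assumed to exist) of the convex problem: minimize over $(x,s)$ $g_0(x) - \langle v_n, x \rangle + \langle t_n, s \rangle$ subject to $G(x) - H(x_n) - D H(x_n)(x - x_n) \preceq_K s$, $s \succeq_K 0$, $x \in Q$. Step 3: set $t_{n+1} = \mu t_n$ if $\|s_{n+1}\| \ge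 \varkappa$ and $\mu \|t_n\| \le \tau_{\max}$, and $t_{n+1} = t_n$ otherwise; set $n := n+1$ and go to Step 1. (The asymptotic statements concern the infinite sequence obtained without stopping; $t_n$ is updated only finitely many times, so $\lim t_n$ exists.) Generalized criticality: for $t \succ_{K^*} 0$, a point $x_* \in Q$ is a generalized $t$-critical point of $(\mathcal{P})$ if there exist $v_* \in \partial h_0(x_* )$ and $s_* \succeq_K 0$ such that $(x_*, s_* )$ is a globally optimal solution of: minimize over $(x,s)$ $g_0(x) - \langle v_*, x \rangle + \langle t, s \rangle$ subject to $G(x) - H(x_* ) - D H(x_* )(x - x_* ) \preceq_K s$, $s \succeq_K 0$, $x \in Q$. Criticality: a point $x_*$ feasible for $(\mathcal{P})$ is critical if $\partial h_0(x_* ) \cap ( \partial g_0(x_* ) + N_{\Omega(x_* )}(x_* ) ) \ne \emptyset$, where $\Omega(x_* ) = \{ x \in Q \mid G(x) - H(x_* ) - D H(x_* )(x - x_* ) \preceq_K 0 \}$ and $N_V(x) = \{ v \mid \langle v, z - x \rangle \le 0 \ \forall z \in V \}$. *)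

(* Defs.v *)
From HB Require Import structures.
From mathcomp Require Import all_boot all_order all_algebra.
From mathcomp Require Import all_classical all_reals all_analysis.

Set Implicit Arguments.
Unset Strict Implicit.
Unset Printing Implicit Defensive.

Import Order.TTheory GRing.Theory Num.Theory.
Import numFieldNormedType.Exports.

Local Open Scope classical_set_scope.
Local Open Scope ring_scope.

(* R^d is 'rV[R]_d. Its library norm is the max norm, which is used below only
   through the topology it induces; the pairing of R^d is the dot product. *)

Section normed_spaces.
Context {R : realType}.

Definition finite_dimensional (Y : lmodType R) : Prop :=
  exists (n : nat) (b : 'I_n -> Y),
    forall y : Y, exists a : 'I_n -> R, y = \sum_(i < n) a i *: b i.

(* Meaningful for bounded linear f; the value of sup is 0 otherwise. *)
Definition op_norm (V W : normedModType R) (f : V -> W) : R :=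
  sup [set `|f v| | v in [set v : V | `|v| <= 1]].

Definition continuously_differentiable (V W : normedModType R) (f : V -> W) :
    Prop :=
  (forall x : V, differentiable f x) /\
  (forall x : V, op_norm ('d f y \- 'd f x) @[y --> x] --> (0 : R)).

Definition dist (Y : normedModType R) (y : Y) (A : set Y) : R :=
  inf [set `|y - a| | a in A].

End normed_spaces.

Section cones.
Context {R : realType} {Y : normedModType R}.
Implicit Types (K : set Y) (t : Y -> R^o).

Definition proper_cone K : Prop :=
  [/\ closed K, convex_set K,
      (forall (a : R) (y : Y), 0 <= a -> K y -> K (a *: y)) &
      K `&` [set - y | y in K] = [set 0]].

Definition generating K : Prop := [set a - b | a in K & b in K] = setT.

Definition cone_le K (x y : Y) : Prop := K (y - x).

(* Elements of Y^* are represented by their underlying functions Y -> R^o. *)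
Definition dual_space : set (Y -> R^o) := [set t | linear t /\ continuous t].

Definition dual_cone K : set (Y -> R^o) :=
  [set t | dual_space t /\ forall y, K y -> 0 <= t y].

Definition dual_pos K t : Prop :=
  dual_cone K t /\ forall y, K y -> y != 0 -> 0 < t y.

Definition K_convex (X : lmodType R) K (G : X -> Y) : Prop :=
  forall (a : R) (x1 x2 : X), 0 <= a <= 1 ->
    cone_le K (G (a *: x1 + (1 - a) *: x2)) (a *: G x1 + (1 - a) *: G x2).

End cones.

Section convex_analysis.
Context {R : realType} {d : nat}.
Local Notation X := 'rV[R]_d.
Implicit Types (f : X -> R) (x v z : X) (A : set X).

Definition dotv v z : R := \sum_(i < d) v 0 i * z 0 i.

Definition closed_convex_function f : Prop :=
  convex_function (setT : set X) f /\ closed [set p : X * R | f p.1 <= p.2].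

Definition subdifferential f x : set X :=
  [set v | forall z, f x + dotv v (z - x) <= f z].

Definition normal_cone A x : set X :=
  [set v | forall z, A z -> dotv v (z - x) <= 0].

End convex_analysis.

Section dc_problem.
Context {R : realType} {d : nat} {Y : normedModType R}.
Local Notation X := 'rV[R]_d.
Variables (g0 h0 : X -> R) (G H : X -> Y) (K : set Y) (Q : set X).

Definition dc_feasible (x : X) : Prop := Q x /\ cone_le K (G x - H x) 0.

Definition penalty_function (c : R) (x : X) : R :=
  g0 x - h0 x + c * dist (G x - H x) [set - k | k in K].

Definition linearized_map (xn x : X) : Y := G x - H xn - 'd H xn (x - xn).

Definition subproblem_feasible (xn : X) : set (X * Y) :=
  [set p | [/\ cone_le K (linearized_map xn p.1) p.2, cone_le K 0 p.2 & Q p.1]].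

Definition subproblem_objective (v : X) (t : Y -> R^o) (p : X * Y) : R :=
  g0 p.1 - dotv v p.1 + t p.2.

Definition subproblem_optimal (xn v : X) (t : Y -> R^o) (p : X * Y) : Prop :=
  subproblem_feasible xn p /\
  forall q, subproblem_feasible xn q ->
    subproblem_objective v t p <= subproblem_objective v t q.

Definition generalized_critical (t : Y -> R^o) (x : X) : Prop :=
  [/\ dual_pos K t, Q x &
      exists (v : X) (s : Y),
        [/\ subdifferential h0 x v, cone_le K 0 s &
            subproblem_optimal x v t (x, s)]].

Definition linearized_set (xs : X) : set X :=
  [set x | Q x /\ cone_le K (linearized_map xs x) 0].

Definition critical (x : X) : Prop :=
  dc_feasible x /\
  subdifferential h0 x `&`
    [set u + w | u in subdifferential g0 x
               & w in normal_cone (linearized_set x) x] !=set0.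

(* A run of the method; the entry s 0 plays no role. *)
Record exact_penalty_DCA (mu tau_max kappa : R)
    (x v : nat -> X) (s : nat -> Y) (t : nat -> Y -> R^o) : Prop := {
  dca_mu : 1 < mu;
  dca_tau_max : 0 < tau_max;
  dca_kappa : 0 <= kappa;
  dca_x0 : Q (x 0%N);
  dca_t0 : dual_pos K (t 0%N);
  dca_subgradient : forall n, subdifferential h0 (x n) (v n);
  dca_step : forall n,
    subproblem_optimal (x n) (v n) (t n) (x n.+1, s n.+1);
  dca_update : forall n,
    t n.+1 = if (kappa <= `|s n.+1|) && (mu * op_norm (t n) <= tau_max)
             then mu *: t n else t n
}.

End dc_problem.

(* Main.v *)
(* Along the run, t_n = mu^k t_0 is eventually constant, since t_0 has positive
   norm. From then on the merit f_0(x_n) + <t, s_n> is nonincreasing: the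
   K-convexity of H makes (x_n, s_n) feasible for the n-th subproblem. It is
   bounded below by the penalty function because <t, s> >= c |s| on K, hence it
   converges. Along an ultrafilter on which x_n converges, s_n and v_n converge
   too, by finite dimension, and optimality passes to the limit, because the
   merit gap vanishes and a perturbation of the linearized constraint is
   absorbed by a multiple of an order unit of K. If the penalty stops growing
   before its largest admissible value, then |s_n| < kappa eventually, which
   bounds the infeasibility; otherwise the non-criticality hypothesis does. A
   feasible limit point has s = 0 and minimizes g_0 - <v, .> over the linearized
   set, so that criticality follows from the subdifferential sum rule. *)
Require Import Defs.
From HB Require Import structures.
From mathcomp Require Import all_boot all_order all_algebra.
From mathcomp Require Import all_classical all_reals all_analysis.
From mathcomp Require Import ring lra.
Import Order.TTheory GRing.Theory Num.Theory.
Import numFieldNormedType.Exports.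
Local Open Scope classical_set_scope.
Local Open Scope ring_scope.

Set Implicit Arguments.
Unset Strict Implicit.
Unset Printing Implicit Defensive.

(** * Ultrafilters and finite-dimensional compactness *)

Section ultrafilters.
Implicit Types T : Type.

(** A cluster point of an ultrafilter is a limit: if the preimage of a neighbourhood were not in
    [U], that of its complement would be, against clustering. *)
Lemma ultra_compact_cvg T (V : topologicalType) (U : set_system T)
    (f : T -> V) (A : set V) :
  UltraFilter U -> compact A -> (\forall n \near U, A (f n)) ->
  exists2 p, A p & f @ U --> p.
Proof.
move=> UU cA UA; have [p [Ap clp]] := cA (f @ U) _ UA.
exists p => // B pB; have [//|UB] := in_ultra_setVsetC (f @^-1` B) UU.
by have [y [nBy By]] := clp (~` B) B UB pB.
Qed.

(** Stands in for extracting a convergent subsequence: the intersections of sets of [F] with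
    preimages of neighbourhoods of [p] form a filter base, and any ultrafilter above it works. *)
Lemma cluster_ultra T (V : topologicalType) (F : set_system T) (f : T -> V) p :
  ProperFilter F -> cluster (f @ F) p ->
  exists U, [/\ UltraFilter U, F `<=` U & f @ U --> p].
Proof.
move=> PF clp.
pose B := [set AB : set T * set V | F AB.1 /\ nbhs p AB.2].
pose G := filter_from B (fun AB => AB.1 `&` f @^-1` AB.2).
have PG : ProperFilter G.
  apply: filter_from_proper; last first.
    move=> [A1 A2] [/= FA pA].
    have [|_ [[x Ax <-] fx]] := clp (f @` A1) A2 _ pA; last by exists x.
    by apply: (@filterS T F _ A1) => // y Ay; exists y.
  apply: filter_from_filter.
    by exists (setT, setT); split; exact: filterT.
  move=> [A1 A2] [B1 B2] [/= FA pA] [/= FB pB].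
  exists (A1 `&` B1, A2 `&` B2); first by split; exact: filterI.
  by move=> x [[? ?] [? ?]].
have [U [UU GU]] := ultraFilterLemma PG.
exists U; split=> // A FA; apply: GU.
- by exists (A, setT) => [|x []//]; split => //; exact: filterT.
- by exists (setT, A) => [|x []//]; split => //; exact: filterT.
Qed.

End ultrafilters.

Section row_vectors.
Context {R : realType} {d : nat}.
Implicit Types h v z : 'rV[R]_d.

Lemma normr_entry_le h i : `|h 0 i| <= `|h|.
Proof.
rewrite [leRHS]/Num.norm /= mx_normrE.
by apply/bigmax_geP; right => /=; exists (0, i).
Qed.

Lemma normr_rV_le h (M : R) :
  0 <= M -> (forall i, `|h 0 i| <= M) -> `|h| <= M.
Proof.
move=> M0 hM; rewrite /Num.norm /= mx_normrE; apply/bigmax_leP;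
  split=> //= ij _.
by rewrite (ord1 ij.1).
Qed.

Lemma compact_rV_ball (M : R) : compact [set h : 'rV[R]_d | `|h| <= M].
Proof.
apply: bounded_closed_compact.
  exists M; split=> [|r Mr h /= hM]; first exact: num_real.
  exact: le_trans hM (ltW Mr).
by apply: closed_comp (@closed_le R M) => h _; exact: norm_continuous.
Qed.

Lemma ultra_rV_cvg T (U : set_system T) (f : T -> 'rV[R]_d) (M : R) :
  UltraFilter U -> (\forall n \near U, `|f n| <= M) ->
  exists p : 'rV[R]_d, f @ U --> p.
Proof.
by move=> UU UM; have [p _ fp] := ultra_compact_cvg UU (@compact_rV_ball M) UM;
  exists p.
Qed.

End row_vectors.

Section finite_dimension.
Context {R : realType} {Y : normedModType R}.

Let lincomb n (b : 'I_n -> Y) (a : 'rV[R]_n) := \sum_(i < n) a 0 i *: b i.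

Let lincomb_continuous n (b : 'I_n -> Y) : continuous (lincomb b).
Proof.
move=> a; have FF : Filter (nbhs a) by exact: nbhs_filter.
apply: (cvg_big (op := +%R)) => [|i _]; first exact: add_continuous.
apply: cvgZr_tmp.
exact: coord_continuous.
Qed.

Let lincombZ n (b : 'I_n -> Y) r a : lincomb b (r *: a) = r *: lincomb b a.
Proof. by rewrite scaler_sumr; apply: eq_bigr => i _; rewrite mxE scalerA. Qed.

(* Shrinking the spanning family until it is independent makes the norm
   bounded away from 0 on the unit sphere of the coefficients. *)
Lemma finite_dimensional_coords : finite_dimensional Y ->
  exists n (b : 'I_n -> Y) (C : R), 0 < C /\
    forall y, exists2 a : 'rV[R]_n,
      y = \sum_(i < n) a 0 i *: b i & `|a| <= C * `|y|.
Proof.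
case=> n [b spanb]; elim: n b spanb => [|n IH] b spanb.
  exists 0%N, b, 1; split=> // y; exists 0; last by rewrite normr0 mul1r.
  by have [a ->] := spanb y; rewrite !big_ord0.
have [[a [a0 ab]]|indep] := pselect (exists a, a != 0 /\ lincomb b a = 0).
  have [i ai] : exists i, a 0 i != 0.
    by move: a0; apply: contra_neqP => /forallNP a0; apply/rowP => i;
      rewrite mxE; apply/eqP; apply: contra_notT (a0 i).
  (* As [a 0 i] is nonzero, [b i] is a combination of the other vectors, which therefore still
     span. *)
  apply: (IH (fun j => b (lift i j))) => y; have [c ->] := spanb y.
  exists (fun j => c (lift i j) - c i / a 0 i * a 0 (lift i j)).
  rewrite (bigD1_ord i) //=.
  under [RHS]eq_bigr do rewrite scalerBl -scalerA.
  rewrite sumrB -scaler_sumr addrC; congr (_ + _).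
  have /eqP := ab; rewrite /lincomb (bigD1_ord i) //= addrC addr_eq0 => /eqP ->.
  by rewrite scalerN opprK scalerA mulfVK.
have [C [C0 bC]] : exists C, 0 < C /\ forall a, `|a| <= C * `|lincomb b a|.
  have cS : compact [set a : 'rV[R]_n.+1 | `|a| = 1].
    apply: (subclosed_compact _ (@compact_rV_ball _ n.+1 1)) => [|a /= ->//].
    apply: (@closed_comp _ _ _ [set r : R | r = 1]) => [h _|];
      last exact: closed_eq.
    exact: norm_continuous.
  have nz : exists a : 'rV[R]_n.+1, `|a| = 1.
    exists (const_mx 1); apply/eqP; rewrite eq_le; apply/andP; split.
      by apply: normr_rV_le => // i; rewrite mxE normr1.
    by apply: le_trans (normr_entry_le _ 0); rewrite mxE normr1.
  have [|a0 /[!inE] /= a01 a0min] :=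
    EVT_min_rV (f := fun a => `|lincomb b a|) nz cS.
    apply: continuous_subspaceT => a.
    apply: (continuous_comp (@lincomb_continuous _ b a)).
    exact: norm_continuous.
  set m := `|lincomb b a0| in a0min.
  have m0 : 0 < m.
    rewrite normr_gt0; apply/eqP => ba0; apply: indep; exists a0; split=> //.
    by rewrite -normr_eq0 a01 oner_eq0.
  exists m^-1; split=> [|a]; first by rewrite invr_gt0.
  have [->|a_neq0] := eqVneq a 0;
    first by rewrite normr0 mulr_ge0 // invr_ge0 ltW.
  have na : 0 < `|a| by rewrite normr_gt0.
  rewrite mulrC ler_pdivlMr // mulrC -ler_pdivlMr //.
  have := a0min (`|a|^-1 *: a); rewrite inE /= normrZ normfV normr_id mulVf
    ?gt_eqF //.
  by move=> /(_ erefl); rewrite lincombZ normrZ normfV normr_id mulrC.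
exists n.+1, b, C; split=> // y; have [c ->] := spanb y.
exists (\row_i c i); first by apply: eq_bigr => i _; rewrite mxE.
by have := bC (\row_i c i); rewrite /lincomb;
  under [in X in _ <= X -> _]eq_bigr do rewrite mxE.
Qed.

(** Coordinates can be chosen bounded, so they converge along [U], and [lincomb b] is continuous. *)
Lemma finite_dimensional_ultra_cvg T (U : set_system T) (f : T -> Y) (M : R) :
  finite_dimensional Y -> UltraFilter U -> (\forall n \near U, `|f n| <= M) ->
  exists p : Y, f @ U --> p.
Proof.
move=> /finite_dimensional_coords [n [b [C [C0 bC]]]] UU UM.
have /choice [co coP] : forall y, exists a : 'rV[R]_n,
    y = lincomb b a /\ `|a| <= C * `|y|.
  by move=> y; have [a ya aC] := bC y; exists a.
have [|a fa] := @ultra_rV_cvg R n _ _ (co \o f) (C * M) UU.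
  by apply: filterS UM => m fM /=; rewrite (le_trans (coP _).2) // ler_pM2l.
exists (lincomb b a).
have -> : f = lincomb b \o (co \o f).
  by apply/funext => m /=; exact: (coP _).1.
exact: cvg_comp fa (@lincomb_continuous _ b a).
Qed.

End finite_dimension.

(** * Identities between linear combinations *)

Section linear_combinations.
Context {R : comPzRingType} {V : lmodType R}.

(** Syntax for proving module identities by reflection: expressions with equal coefficients at each
    atom have equal values, which leaves scalar identities to [ring]. *)
Inductive lin_expr :=
| LinVar of nat
| LinZero
| LinAdd of lin_expr & lin_expr
| LinOpp of lin_expr
| LinScale of R & lin_expr.

Fixpoint lin_eval (s : seq V) e : V :=
  match e with
  | LinVar n => s`_n
  | LinZero => 0
  | LinAdd e1 e2 => lin_eval s e1 + lin_eval s e2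
  | LinOpp e1 => - lin_eval s e1
  | LinScale r e1 => r *: lin_eval s e1
  end.

(* [Nat.eqb] rather than [==], for [cbn] to compute the coefficients. *)
Fixpoint lin_coef (i : nat) e : R :=
  match e with
  | LinVar n => if PeanoNat.Nat.eqb n i then 1 else 0
  | LinZero => 0
  | LinAdd e1 e2 => lin_coef i e1 + lin_coef i e2
  | LinOpp e1 => - lin_coef i e1
  | LinScale r e1 => r * lin_coef i e1
  end.

(** Bounded quantification as an iterated conjunction, so that it computes to one goal per atom. *)
Fixpoint lin_all (n : nat) (P : nat -> Prop) : Prop :=
  if n is m.+1 then P 0%N /\ lin_all m (fun i => P i.+1) else True.

Lemma lin_allP n (P : nat -> Prop) :
  lin_all n P -> forall i, (i < n)%N -> P i.
Proof.
elim: n P => [//|n IH] P /= [P0 Pn] [//|i] ltin.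
exact: (IH (fun i => P i.+1)).
Qed.

Lemma lin_evalE s e :
  lin_eval s e = \sum_(i < size s) lin_coef i e *: s`_i.
Proof.
elim: e => [n||e1 IH1 e2 IH2|e IH|r e IH] /=.
- case: (ltnP n (size s)) => sn; last first.
    (* An index out of range evaluates to the default 0. *)
    rewrite nth_default // big1 // => i _; case: PeanoNat.Nat.eqb_spec => [ni|].
      by move: sn; rewrite ni leqNgt ltn_ord.
    by rewrite scale0r.
  rewrite (bigD1 (Ordinal sn)) //= PeanoNat.Nat.eqb_refl scale1r big1 ?addr0 //
    => i.
  rewrite -val_eqE /= => /eqP ni.
  by case: PeanoNat.Nat.eqb_spec => [/esym//|]; rewrite scale0r.
- by rewrite big1 // => i _; rewrite scale0r.
- by rewrite IH1 IH2 -big_split /=; apply: eq_bigr => i _; rewrite scalerDl.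
- by rewrite IH -sumrN; apply: eq_bigr => i _; rewrite scaleNr.
- by rewrite IH scaler_sumr; apply: eq_bigr => i _; rewrite scalerA.
Qed.

Lemma lin_eval_eq s e1 e2 :
  lin_all (size s) (fun i => lin_coef i e1 = lin_coef i e2) ->
  lin_eval s e1 = lin_eval s e2.
Proof.
move=> /lin_allP eqc; rewrite !lin_evalE; apply: eq_bigr => i _.
by rewrite eqc.
Qed.

End linear_combinations.

Ltac lin_mem x s :=
  lazymatch s with
  | nil => constr:(false)
  | cons x _ => constr:(true)
  | cons _ ?s' => lin_mem x s'
  end.

Ltac lin_index x s :=
  lazymatch s with
  | cons x _ => constr:(0%N)
  | cons _ ?s' => let n := lin_index x s' in constr:(S n)
  end.

Ltac lin_atoms t s :=
  lazymatch t with
  | 0%R => s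
  | (?a + ?b)%R => let s' := lin_atoms a s in lin_atoms b s'
  | (- ?a)%R => lin_atoms a s
  | (_ *: ?a)%R => lin_atoms a s
  | _ => lazymatch lin_mem t s with
         | true => s
         | false => constr:(cons t s)
         end
  end.

Ltac lin_reify R t s :=
  lazymatch t with
  | 0%R => constr:(@LinZero R)
  | (?a + ?b)%R =>
      let a' := lin_reify R a s in
      let b' := lin_reify R b s in constr:(@LinAdd R a' b')
  | (- ?a)%R => let a' := lin_reify R a s in constr:(@LinOpp R a')
  | (?r *: ?a)%R => let a' := lin_reify R a s in constr:(@LinScale R r a')
  | _ => let n := lin_index t s in constr:(@LinVar R n)
  end.

(* Leaves to the user the coefficients that [ring] cannot compare. Atoms are
   matched syntactically: [set] those that agree only up to conversion. *)
Ltac linear_identity R :=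
  lazymatch goal with
  | |- @eq ?T ?a ?b =>
      let s1 := lin_atoms a (@nil T) in
      let s := lin_atoms b s1 in
      let e1 := lin_reify R a s in
      let e2 := lin_reify R b s in
      apply: (@lin_eval_eq _ _ s e1 e2);
        cbn [size lin_all lin_coef PeanoNat.Nat.eqb];
      do ?[split]; try ring
  end.

(** * Cones and cone-convex maps *)

Lemma convex_set_segment (R : numDomainType) (V : lmodType R) (A : set V)
    (a : R) (x y : V) :
  convex_set A -> 0 <= a <= 1 -> A x -> A y -> A (a *: x + (1 - a) *: y).
Proof.
move=> cA /andP[a0 a1] Ax Ay.
by have := cA x y (Itv01 a0 a1); rewrite !inE; exact.
Qed.

Section cone_theory.
Context {R : realType} {Y : normedModType R}.
Variable K : set Y.
Hypothesis K_proper : proper_cone K.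

Lemma coneZ (a : R) y : 0 <= a -> K y -> K (a *: y).
Proof. by case: K_proper => _ _ KZ _; exact: KZ. Qed.

Lemma cone0 : K 0.
Proof.
have [_ _ _ eK] := K_proper; have : [set 0 : Y] 0 by [].
by rewrite -eK => -[].
Qed.

(** The sum is twice the midpoint, which convexity and homogeneity keep in [K]. *)
Lemma coneD a b : K a -> K b -> K (a + b).
Proof.
move=> Ka Kb; have [_ cK _ _] := K_proper.
have h01 : 0 <= (2^-1 : R) <= 1 by apply/andP; split; lra.
have := convex_set_segment cK h01 Ka Kb => /(@coneZ 2 _ (ler0n _ _)).
rewrite (_ : 2 *: _ = a + b) //.
by linear_identity R; field.
Qed.

Lemma cone_sum n (f : 'I_n -> Y) : (forall i, K (f i)) -> K (\sum_i f i).
Proof.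
move=> Kf; elim/big_ind : _ => //; [exact: cone0|exact: coneD].
Qed.

Lemma cone_closed : closed K.
Proof. by case: K_proper. Qed.

(** Each spanning vector [b i] is a difference of [p i] and [p i - b i], both in [K]. Summing all of
    these and scaling by [C] gives the unit, since the coordinates of [w] are at most [C] times its
    norm. *)
Lemma generating_cone_unit : finite_dimensional Y -> generating K ->
  exists2 e, K e & forall w, K (`|w| *: e - w).
Proof.
move=> /finite_dimensional_coords [n [b [C [C0 bC]]]] genK.
have /choice[p pP] : forall i, exists p, K p /\ K (p - b i).
  move=> i; have : [set: Y] (b i) by [].
  by rewrite -genK => -[p Kp [q Kq <-]]; exists p; rewrite subKr.
have Ke : K (\sum_i (p i + (p i - b i))).
  by apply: cone_sum => i; apply: coneD; case: (pP i).
exists (C *: \sum_i (p i + (p i - b i))) => [|w].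
  by apply: coneZ; rewrite ?ltW.
have [a -> aC] := bC w; set w' := \sum_i _ in aC *.
rewrite scalerA scaler_sumr /w' -sumrB; apply: cone_sum => i.
have {}aC : `|a 0 i| <= `|w'| * C.
  by rewrite mulrC; exact: le_trans (normr_entry_le _ _) aC.
have /andP[aC1 aC2] : - (`|w'| * C) <= a 0 i <= `|w'| * C by rewrite -ler_norml.
rewrite (_ : _ - _ = (`|w'| * C - a 0 i) *: p i +
                     (`|w'| * C + a 0 i) *: (p i - b i)).
  by apply: coneD; apply: coneZ; [lra|case: (pP i)|lra|case: (pP i)].
by linear_identity R.
Qed.

End cone_theory.

Section K_convex_continuity.
Context {R : realType} {d : nat} {Y : normedModType R}.
Variables (K : set Y) (G : 'rV[R]_d -> Y).
Hypotheses (K_proper : proper_cone K) (G_convex : K_convex K G).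
Variable e : Y.
Hypotheses (Ke : K e) (e_unit : forall w, K (`|w| *: e - w)).

(** Induction on the number of free coordinates: a point of the cube lies between the two faces
    where the last free coordinate is 1 and -1, and convexity carries the bounds on these faces over
    to it. *)
Let order_bounded_above (k : nat) x0 :
  exists M : R, forall h : 'rV[R]_d, (forall i, `|h 0 i| <= 1) ->
    (forall i : 'I_d, (k <= i)%N -> h 0 i = 0) -> K (M *: e - G (x0 + h)).
Proof.
elim: k x0 => [|k IH] x0.
  exists `|G x0| => h _ h0; rewrite (_ : h = 0) ?addr0 //.
  by apply/rowP => i; rewrite h0 // mxE.
have [dk|kd] := leqP d k.
  have [M KM] := IH x0; exists M => h h1 _; apply: KM => // i ki.
  by have := leq_trans dk ki; rewrite leqNgt ltn_ord.
pose u : 'rV[R]_d := delta_mx 0 (Ordinal kd).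
have [M1 KM1] := IH (x0 + u); have [M2 KM2] := IH (x0 - u).
exists (`|M1| + `|M2|) => h h1 h0.
set r := h 0 (Ordinal kd); pose h' := h - r *: u.
have /andP[r1 r2] : -1 <= r <= 1 by rewrite -ler_norml; exact: h1.
have h'E i : h' 0 i = if i == Ordinal kd then 0 else h 0 i.
  rewrite !mxE eqxx /=; case: eqP => [->|_]; first by rewrite mulr1 subrr.
  by rewrite mulr0 subr0.
have h'1 i : `|h' 0 i| <= 1 by rewrite h'E; case: ifP => // _; rewrite normr0.
have h'0 (i : 'I_d) : (k <= i)%N -> h' 0 i = 0.
  rewrite h'E leq_eqVlt -val_eqE /= [k == _]eq_sym.
  by case: (_ == k) => //= ki; exact: h0.
have Q1 := KM1 _ h'1 h'0; have Q2 := KM2 _ h'1 h'0.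
(* The weight for which [a - (1 - a) = r], the coordinate to be recovered. *)
pose a := (1 + r) / 2.
have a0 : 0 <= a by rewrite /a; lra.
have a1 : 0 <= 1 - a by rewrite /a; lra.
have a01 : 0 <= a <= 1 by rewrite a0 -subr_ge0.
have := G_convex (x0 + u + h') (x0 - u + h') a01; rewrite /cone_le.
rewrite (_ : a *: _ + _ = x0 + h); last first.
  by rewrite /h' /a; linear_identity R; field.
set y := G (x0 + h); set y1 := G _ in Q1 *; set y2 := G _ in Q2 * => Q3.
rewrite (_ : _ - y = (a *: y1 + (1 - a) *: y2 - y) + (a *: (M1 *: e - y1) +
   ((1 - a) *: (M2 *: e - y2) + (`|M1| + `|M2| - a * M1 - (1 - a) * M2) *: e)));
  last by linear_identity R.
have M1n := ler_norm M1; have M2n := ler_norm M2.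
have M10 := normr_ge0 M1; have M20 := normr_ge0 M2.
apply: coneD => //; apply: coneD => //; first exact: coneZ.
by apply: coneD => //; apply: coneZ => //; nra.
Qed.

(* [L] makes the cone normal: order intervals are bounded in norm. *)
Variables (L : {linear Y -> R^o}) (c : R).
Hypotheses (c_gt0 : 0 < c) (L_ge : forall y, K y -> c * `|y| <= L y).

(** The upper bound on the cube controls increments of [G] from above along [u] and, by reflection
    through [x0], from below; [L] turns the resulting order interval into a norm bound. *)
Lemma K_convex_lipschitz_at x0 :
  exists M : R, forall h, `|h| <= 1 -> `|G (x0 + h) - G x0| <= M * `|h|.
Proof.
have [B KB] := order_bounded_above d x0.
pose E := B *: e - G x0.
exists (L (2 *: E) / c + `|E|) => h h1.
have [->|h0] := eqVneq h 0; first by rewrite addr0 subrr !normr0 mulr0.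
set r := `|h| in h1 *; have r0 : 0 < r by rewrite normr_gt0.
pose u := r^-1 *: h.
have hu : h = r *: u by rewrite scalerA mulfV ?scale1r ?gt_eqF.
have u1 i : `|u 0 i| <= 1.
  rewrite mxE normrM normfV [in X in X^-1]ger0_norm ?(ltW r0) //.
  by rewrite ler_pdivrMl // mulr1; exact: normr_entry_le.
have Bp : K (B *: e - G (x0 + u)) by apply: KB => // i; rewrite leqNgt ltn_ord.
have Bn : K (B *: e - G (x0 - u)).
  by apply: KB => // i; [rewrite mxE normrN|rewrite leqNgt ltn_ord].
rewrite hu; set D := G _ - _.
have up : K (r *: E - D).
  have r01 : 0 <= r <= 1 by rewrite ltW.
  have := G_convex (x0 + u) x0 r01.
  rewrite /cone_le (_ : r *: _ + _ = x0 + r *: u); last by linear_identity R.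
  move=> Q.
  rewrite (_ : _ - D =
      (r *: G (x0 + u) + (1 - r) *: G x0 - G (x0 + r *: u))
      + r *: (B *: e - G (x0 + u))); last by rewrite /E /D; linear_identity R.
  by apply: coneD => //; apply: coneZ => //; exact: ltW.
have r1 : 0 < 1 + r by lra.
have lo : K (r *: E + D).
  (* With this weight [x0] is the convex combination of [x0 + r *: u] and [x0 - u]. *)
  pose a := (1 + r)^-1.
  have a0 : 0 < a by rewrite invr_gt0.
  have a1 : a * (1 + r) = 1 by rewrite mulVf ?gt_eqF.
  have a01 : 0 <= a <= 1.
    by rewrite ltW //= invf_le1 // lerDl ltW.
  have := G_convex (x0 + r *: u) (x0 - u) a01.
  rewrite /cone_le (_ : a *: _ + _ = x0); last first.
    by rewrite /a; linear_identity R; field; lra.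
  move=> /(coneZ K_proper (ltW r1)) Q.
  rewrite (_ : _ + D =
      (1 + r) *: (a *: G (x0 + r *: u) + (1 - a) *: G (x0 - u) - G x0)
      + r *: (B *: e - G (x0 - u))).
    by apply: coneD => //; apply: coneZ => //; exact: ltW.
  by rewrite /E /D /a; linear_identity R; field; lra.
(* Both [r *: E + D] and [r *: E - D] lie in [K], so [L] at the first is at most the sum
   [r * L (2 *: E)] of the two values. *)
have nLo : `|r *: E + D| <= r * (L (2 *: E) / c).
  rewrite mulrA ler_pdivlMr // mulrC; apply: le_trans (L_ge lo) _.
  have : 0 <= L (r *: E - D) by apply: le_trans (L_ge up);
    rewrite mulr_ge0 // ltW.
  have -> : r * L (2 *: E) = L (r *: E + D) + L (r *: E - D).
    rewrite -linearD -[r * _]/(r *: L _) -linearZ; congr (L _).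
    by linear_identity R.
  lra.
rewrite (_ : D = (r *: E + D) - r *: E); last by linear_identity R.
apply: le_trans (ler_normB _ _) _; rewrite normrZ (ger0_norm (ltW r0)).
by rewrite mulrDl lerD // mulrC.
Qed.

Lemma K_convex_continuous : continuous G.
Proof.
move=> x0; have [M GM] := K_convex_lipschitz_at x0.
have FF : Filter (nbhs x0) by exact: nbhs_filter.
apply/cvgrPdist_le => eps eps0.
have M0 : 0 < `|M| + 1 by rewrite ltr_wpDl.
near=> x.
have xx1 : `|x - x0| <= 1.
  near: x; apply: (@cvgr_distC_le _ _ _ _ _ id x0) => //; try exact: divr_gt0;
    exact: cvg_id.
have xx2 : `|x - x0| <= eps / (`|M| + 1).
  near: x; apply: (@cvgr_distC_le _ _ _ _ _ id x0) => //; try exact: divr_gt0;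
    exact: cvg_id.
rewrite distrC -(subrKC x0 x); apply: le_trans (GM _ xx1) _.
move: xx2; rewrite ler_pdivlMr //.
have := normr_ge0 (x - x0); have := ler_norm M; nra.
Unshelve. all: by end_near. Qed.

End K_convex_continuity.

(** * Real convex functions *)

Section convex_functions.
Context {R : realType} {d : nat}.
Implicit Types (f g : 'rV[R]_d -> R) (u v w x y z h : 'rV[R]_d).

Lemma dotvDl u v w : dotv (u + v) w = dotv u w + dotv v w.
Proof. by rewrite -big_split; apply: eq_bigr => i _; rewrite mxE mulrDl. Qed.

Lemma dotvZl (a : R) u w : dotv (a *: u) w = a * dotv u w.
Proof. by rewrite mulr_sumr; apply: eq_bigr => i _; rewrite mxE mulrA. Qed.

Lemma dotvC u w : dotv u w = dotv w u.
Proof. by apply: eq_bigr => i _; rewrite mulrC. Qed.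

Lemma dotvDr u v w : dotv w (u + v) = dotv w u + dotv w v.
Proof. by rewrite !(dotvC w) dotvDl. Qed.

Lemma dotvZr (a : R) u w : dotv w (a *: u) = a * dotv w u.
Proof. by rewrite !(dotvC w) dotvZl. Qed.

Lemma dotvNr u w : dotv w (- u) = - dotv w u.
Proof. by rewrite -scaleN1r dotvZr mulN1r. Qed.

Lemma dotvNl u w : dotv (- w) u = - dotv w u.
Proof. by rewrite dotvC dotvNr dotvC. Qed.

Lemma dotv0r w : dotv w 0 = 0.
Proof. by rewrite -(scale0r 0) dotvZr mul0r. Qed.

Lemma dotv_delta w i : dotv w (delta_mx 0 i) = w 0 i.
Proof.
rewrite /dotv (bigD1 i) //= mxE !eqxx mulr1 big1 ?addr0 // => j /negPf ji.
by rewrite mxE ji andbF mulr0.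
Qed.

Lemma cvg_dotv T (F : set_system T) (f g : T -> 'rV[R]_d) u v :
  Filter F -> f @ F --> u -> g @ F --> v ->
  dotv (f n) (g n) @[n --> F] --> dotv u v.
Proof.
move=> FF fu gv; apply: (cvg_big (op := +%R)) => [|i _].
  exact: add_continuous.
have coord := @coord_continuous R 1 d 0 i.
by apply: cvgM; [exact: (cvg_comp f (fun h => h 0 i) fu (coord u))|
  exact: (cvg_comp g (fun h => h 0 i) gv (coord v))].
Qed.

Lemma convex_function_segment f (a : R) x y :
  convex_function setT f -> 0 <= a <= 1 ->
  f (a *: x + (1 - a) *: y) <= a * f x + (1 - a) * f y.
Proof.
by move=> cf /andP[a0 a1]; have := cf (Itv01 a0 a1) x y; rewrite !inE; exact.
Qed.

(** Convexity is [K_convex] for the half-line of nonnegative reals, with order unit 1 and the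
    identity as [L]. *)
Lemma convex_function_continuous f : convex_function setT f -> continuous f.
Proof.
move=> cf.
have K_proper : proper_cone [set r : R^o | 0 <= r].
  split.
  - exact: closed_ge.
  - move=> x y a; rewrite !inE /= => x0 y0.
    by rewrite addr_ge0 // mulr_ge0 //= subr_ge0.
  - by move=> a y a0 /= y0; rewrite mulr_ge0.
  - apply/seteqP; split=> [r [/= r0 [s s0 sr]]|_ ->].
      by apply/eqP; rewrite eq_le r0 -sr oppr_le0 s0.
    by split=> /=; [|exists 0; rewrite ?oppr0 /=].
apply: (K_convex_continuous (Y := R^o) K_proper _ (e := 1) _ _ (L := idfun)
  ltr01).
- move=> a x y a01; rewrite /cone_le /= subr_ge0.
  exact: convex_function_segment.
- exact: ler01.
- by move=> r /=; rewrite subr_ge0 [_ *: _]mulr1 ler_norm.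
- by move=> r /= r0; rewrite mul1r ger0_norm.
Qed.

(* Hahn-Banach in finite dimension, one coordinate at a time; [P] plays the role
   of the (convex) epigraph of a function whose value at [0] is [r0]. *)
Lemma supporting_functional (P : 'rV[R]_d -> R -> Prop) (r0 : R) :
  (forall a h1 r1 h2 r2, 0 <= a <= 1 -> P h1 r1 -> P h2 r2 ->
    P (a *: h1 + (1 - a) *: h2) (a * r1 + (1 - a) * r2)) ->
  (forall h, exists r, P h r) -> (forall r, P 0 r -> r0 <= r) ->
  exists u, forall h r, P h r -> r0 + dotv u h <= r.
Proof.
move=> convP totP minP.
suff H k : exists u, forall h r, (forall i : 'I_d, (k <= i)%N -> h 0 i = 0) ->
    P h r -> r0 + dotv u h <= r.
  by have [u Hu] := H d; exists u => h r; apply: Hu => i;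
    rewrite leqNgt ltn_ord.
elim: k => [|k [u IH]].
  exists 0 => h r h0; rewrite (_ : h = 0); last by apply/rowP => i;
    rewrite h0 // mxE.
  by rewrite dotv0r addr0; exact: minP.
have [dk|kd] := leqP d k.
  by exists u => h r _; apply: IH => i ki; have := leq_trans dk ki;
    rewrite leqNgt ltn_ord.
pose V := [set h : 'rV[R]_d | forall i : 'I_d, (k <= i)%N -> h 0 i = 0].
pose e : 'rV[R]_d := delta_mx 0 (Ordinal kd).
(* Slopes from the negative side of [e] lie below those from the positive side: a convex combination
   of the two points falls in [V], where [IH] applies. *)
have key h1 h2 s1 s2 r1 r2 : V h1 -> V h2 -> 0 < s1 -> 0 < s2 ->
    P (h1 - s1 *: e) r1 -> P (h2 + s2 *: e) r2 ->
    (r0 + dotv u h1 - r1) / s1 <= (r2 - r0 - dotv u h2) / s2.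
  move=> V1 V2 s10 s20 P1 P2.
  have s0 : 0 < s1 + s2 by exact: addr_gt0.
  (* The weight that cancels the [e] components [s2] and [- s1]. *)
  pose a := s1 / (s1 + s2).
  have a01 : 0 <= a <= 1.
    by rewrite /a divr_ge0 ?(ltW s0) ?(ltW s10) //= ler_pdivrMr //
      mul1r lerDl ltW.
  have Q := convP _ _ _ _ _ a01 P2 P1.
  have : r0 + dotv u (a *: h2 + (1 - a) *: h1) <= a * r2 + (1 - a) * r1.
    apply: IH => [i ki|]; first by rewrite !mxE V1 // V2 // !mulr0 addr0.
    rewrite (_ : _ + _ = a *: (h2 + s2 *: e) + (1 - a) *: (h1 - s1 *: e)) //.
    by rewrite /a; linear_identity R; field; lra.
  rewrite dotvDr !dotvZr => /(ler_wpM2l (ltW s0)).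
  have -> : (s1 + s2) * (r0 + (a * dotv u h2 + (1 - a) * dotv u h1)) =
      s1 * (r0 + dotv u h2) + s2 * (r0 + dotv u h1).
    by rewrite /a; field; lra.
  have -> : (s1 + s2) * (a * r2 + (1 - a) * r1) = s1 * r2 + s2 * r1.
    by rewrite /a; field; lra.
  by rewrite ler_pdivrMr // mulrAC ler_pdivlMr //; lra.
have V0 : V 0 by move=> i _; rewrite mxE.
pose S := [set q : R | exists h s r,
  [/\ V h, 0 < s, P (h - s *: e) r & q = (r0 + dotv u h - r) / s]].
have ubS h s r : V h -> 0 < s -> P (h + s *: e) r ->
    ubound S ((r - r0 - dotv u h) / s).
  move=> Vh s0 Pr q [h1 [s1 [r1 [V1 s10 P1 ->]]]]; exact: key P1 Pr.
have S0 : S !=set0.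
  have [r Pr] := totP (0 - 1 *: e).
  by exists ((r0 + dotv u 0 - r) / 1), 0, 1, r.
have bS : has_ubound S.
  have [r Pr] := totP (0 + 1 *: e).
  by eexists; exact: (ubS _ _ _ V0 ltr01 Pr).
(* The new coordinate of [u] may be any number between the lower and the upper slopes; the sign of
   [s] decides below which of the two bounds is needed. *)
pose al := sup S.
exists (u + (al - u 0 (Ordinal kd)) *: e) => h r h0 Pr.
set s := h 0 (Ordinal kd); pose h' := h - s *: e.
have Vh' : V h'.
  move=> i; rewrite !mxE eqxx /= leq_eqVlt => /orP[/eqP ki|ki].
    by rewrite (_ : i = Ordinal kd) ?eqxx ?mulr1 ?subrr //; apply: val_inj.
  by rewrite h0 // -val_eqE /= gtn_eqF // mulr0 subr0.
have hE : h = h' + s *: e by rewrite /h'; linear_identity R.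
rewrite hE in Pr.
have -> : dotv (u + (al - u 0 (Ordinal kd)) *: e) h = dotv u h' + s * al.
  rewrite dotvDl dotvZl (dotvC e) dotv_delta {1}hE dotvDr dotvZr dotv_delta.
  by rewrite -/s; ring.
have [s0|s0|s0] := ltgtP s 0.
- have : (r0 + dotv u h' - r) / - s <= al.
    apply: ub_le_sup => //; exists h', (- s), r; split=> //;
      first by rewrite oppr_gt0.
    by rewrite scaleNr opprK.
  by rewrite ler_pdivrMr ?oppr_gt0 //; lra.
- have : al <= (r - r0 - dotv u h') / s.
    by apply: ge_sup => //; exact: (ubS h' s r Vh' s0 Pr).
  by rewrite ler_pdivlMr //; lra.
- by rewrite s0 mul0r addr0; apply: IH => //; rewrite s0 scale0r addr0 in Pr.
Qed.

(** The infimum of the tilted function [g - dotv v] over [A] shifted by [h] is convex in [h]. A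
    supporting functional [p] of it at 0 splits [v] into the subgradient [p + v] and the normal
    [- p]. *)
Lemma constrained_minimizer_subdifferential g (A : set 'rV[R]_d) v x :
  convex_function setT g ->
  (forall a y z, 0 <= a <= 1 -> A y -> A z -> A (a *: y + (1 - a) *: z)) ->
  A x -> (forall z, A z -> g x - dotv v x <= g z - dotv v z) ->
  [set u + w | u in subdifferential g x & w in normal_cone A x] v.
Proof.
move=> cg cA Ax xmin.
pose P h r := exists y, A y /\ g (y + h) - dotv v (y + h) <= r.
have [|||p Pp] := @supporting_functional P (g x - dotv v x).
- move=> a h1 r1 h2 r2 a01 [y1 [A1 P1]] [y2 [A2 P2]].
  exists (a *: y1 + (1 - a) *: y2); split; first exact: cA.
  rewrite (_ : _ + _ + (a *: h1 + _) = a *: (y1 + h1) + (1 - a) *: (y2 + h2));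
    last by linear_identity R.
  have := convex_function_segment (y1 + h1) (y2 + h2) cg a01.
  move: a01 => /andP[a0]; rewrite -subr_ge0 => a1.
  rewrite dotvDr !dotvZr.
  have := ler_wpM2l a0 P1; have := ler_wpM2l a1 P2; lra.
- by move=> h; exists (g (x + h) - dotv v (x + h)), x.
- by move=> r [y [Ay]]; rewrite addr0; exact: le_trans (xmin _ Ay).
exists (p + v); last exists (- p).
- move=> z; have := Pp (z - x) (g z - dotv v z).
  rewrite /P dotvDl !dotvDr !dotvNr => H; suff: P (z - x) (g z - dotv v z).
    by move=> /H; lra.
  by exists x; rewrite subrKC.
(* Shifting the base point [z] by [x - z] leads back to [x], where the minimal value is taken. *)
- move=> z Az; rewrite dotvNl -dotvNr opprB.
  have := Pp (x - z) (g x - dotv v x); suff: P (x - z) (g x - dotv v x).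
    by move=> + H => /H; lra.
  by exists z; rewrite subrKC.
- by rewrite addrAC subrr add0r.
Qed.

End convex_functions.

(** * Operator norms and differentials *)

Section operator_norm.
Context {R : realType} {V W : normedModType R}.
Implicit Types f : {linear V -> W}.

Lemma continuous_linear_bound f : continuous f ->
  exists C : R, forall v, `|f v| <= C * `|v|.
Proof.
move=> cf; have /linear_boundedP [C [_ fC]] : bounded_near f (nbhs 0).
  by apply: continuous_linear_bounded; exact: cf.
by exists (C + 1); apply: fC; rewrite ltrDl.
Qed.

Let op_norm_ubound f : continuous f ->
  has_ubound [set `|f v| | v in [set v : V | `|v| <= 1]].
Proof.
move=> /continuous_linear_bound [C fC]; exists `|C| => _ [v /= v1 <-].
apply: le_trans (fC v) _; apply: le_trans (ler_norm _) _.
by rewrite normrM normr_id ler_piMr.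
Qed.

Lemma op_norm_bound f v : continuous f -> `|f v| <= op_norm f * `|v|.
Proof.
move=> cf; have [->|v0] := eqVneq v 0; first by rewrite linear0 !normr0 mulr0.
have nv : 0 < `|v| by rewrite normr_gt0.
rewrite -ler_pdivrMr //; apply: ub_le_sup; first exact: op_norm_ubound.
exists (`|v|^-1 *: v) => /=.
  by rewrite normrZ normfV normr_id mulVf ?gt_eqF.
by rewrite linearZ /= normrZ normfV normr_id mulrC.
Qed.

Lemma op_norm_le f (C : R) : 0 <= C -> (forall v, `|f v| <= C * `|v|) ->
  op_norm f <= C.
Proof.
move=> C0 fC; apply: ge_sup => [|_ [v /= v1 <-]].
  by exists `|f 0|, 0 => //=; rewrite normr0.
by apply: le_trans (fC v) _; rewrite ler_piMr.
Qed.

Lemma op_norm_ge0 f : continuous f -> 0 <= op_norm f.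
Proof.
move=> cf; apply: (@le_trans _ _ `|f 0|) => //.
by apply: ub_le_sup; [exact: op_norm_ubound|exists 0 => //=; rewrite normr0].
Qed.

End operator_norm.

Lemma op_normZ (R : realType) (V W : normedModType R) (f : {linear V -> W})
    (a : R) :
  0 < a -> continuous f -> op_norm (a *: (f : V -> W)) = a * op_norm f.
Proof.
move=> a0 cf; apply/eqP; rewrite eq_le; apply/andP; split.
  apply: (@op_norm_le _ _ _ (a \*: f : {linear V -> W})).
    by rewrite mulr_ge0 ?op_norm_ge0 // ltW.
  by move=> v; rewrite /= normrZ gtr0_norm // -mulrA ler_pM2l // op_norm_bound.
rewrite -ler_pdivlMl //; apply: op_norm_le.
  rewrite mulr_ge0 // ?invr_ge0 ?(ltW a0) //.
  apply: (@op_norm_ge0 _ _ _ (a \*: f : {linear V -> W})) => v.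
  by apply: cvgZl_tmp; exact: cf.
move=> v; rewrite -mulrA ler_pdivlMl //.
have := @op_norm_bound _ _ _ (a \*: f : {linear V -> W}) v.
rewrite /= normrZ gtr0_norm //; apply => w.
by apply: cvgZl_tmp; exact: cf.
Qed.

(** Splits off the derivative at [x0]: the rest is bounded by an operator norm that tends to 0,
    times a convergent factor. *)
Lemma cvg_diff_apply (R : realType) (V W : normedModType R) (H : V -> W)
    T (F : set_system T) (x y : T -> V) x0 y0 :
  Filter F -> continuously_differentiable H -> x @ F --> x0 -> y @ F --> y0 ->
  'd H (x n) (y n) @[n --> F] --> 'd H x0 y0.
Proof.
move=> FF [dH dH1] xF yF.
have cd z : continuous ('d H z) by exact: diff_continuous.
have -> : (fun n => 'd H (x n) (y n)) =
    (fun n => ('d H (x n) \- 'd H x0) (y n) + 'd H x0 (y n)).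
  by apply/funext => n /=; rewrite subrK.
rewrite -[X in _ --> X]add0r; apply: cvgD; last first.
  exact: (cvg_comp y ('d H x0) yF (cd x0 y0)).
apply/norm_cvg0P.
have cdB z : continuous ('d H z \- 'd H x0).
  by move=> v; apply: cvgB; exact: cd.
have h0 : op_norm ('d H (x n) \- 'd H x0) * `|y n| @[n --> F] --> (0 : R).
  rewrite -[X in _ --> X](mul0r `|y0|); apply: cvgM; last exact: cvg_norm.
  exact: (cvg_comp x (fun z => op_norm ('d H z \- 'd H x0)) xF (dH1 x0)).
apply: (squeeze_cvgr _ (cvg_cst 0) h0).
apply: nearW => n; rewrite normr_ge0 /=.
exact: (@op_norm_bound _ _ _ ('d H (x n) \- 'd H x0 : {linear V -> W}) _
  (cdB _)).
Qed.

(** * Gradient inequality and distance to the negative cone *)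

Section cone_calculus.
Context {R : realType} {Y : normedModType R}.
Variable K : set Y.
Hypothesis K_proper : proper_cone K.

(** By convexity the difference quotients with step [r] in (0, 1] are below [H z - H x], and the
    closed cone keeps this in the limit. *)
Lemma K_convex_gradient (V : normedModType R) (H : V -> Y) x z :
  K_convex K H -> differentiable H x -> K (H z - H x - 'd H x (z - x)).
Proof.
move=> cH dH; rewrite -deriveE //.
pose q (r : R) := r^-1 *: (H (r *: (z - x) + x) - H x).
have /cvg_dnbhs_at_right qD : q r @[r --> 0^'] --> 'D_(z - x) H x.
  exact: diff_derivable.
have cq : (H z - H x - q r) @[r --> 0^'+] --> H z - H x - 'D_(z - x) H x.
  by apply: cvgB => //; exact: cvg_cst.
apply: (closed_cvg K (cone_closed K_proper) _ _ cq).
near=> r.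
have r0 : 0 < r by [].
have r1 : r <= 1 by near: r; exact: nbhs_right_le.
have r01 : 0 <= r <= 1 by rewrite ltW.
have := cH r z x r01 => /(coneZ K_proper (a := r^-1));
  rewrite invr_ge0 => /(_ (ltW r0)).
rewrite (_ : _ *: z + _ = r *: (z - x) + x); last by linear_identity R.
congr K; rewrite /q; linear_identity R; field; exact: lt0r_neq0.
Unshelve. all: by end_near. Qed.

Lemma dist_opp_cone_le y k : K k -> dist y [set - a | a in K] <= `|y + k|.
Proof.
move=> Kk; apply: ge_inf.
  by exists 0 => _ [? _ <-].
by exists (- k); [exists k|rewrite opprK].
Qed.

Lemma dist_opp_cone_eq0 y : dist y [set - a | a in K] <= 0 -> K (- y).
Proof.
move=> dy0; apply: (cone_closed K_proper).
rewrite closureEnbhs /= => B C KB /nbhs_ballP [e /= e0 eC].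
have hi : has_inf [set `|y - a| | a in [set - a | a in K]].
  split; last by exists 0 => _ [? _ <-].
  by exists `|y - (- 0)|, (- 0) => //; exists 0 => //; exact: cone0.
have [_ [_ [k Kk <-] <-]] := inf_adherent e0 hi.
rewrite opprK => /lt_le_trans; rewrite -/(dist _ _).
move=> /(_ e); rewrite gerDr => /(_ dy0) ke.
exists k; split; first exact: KB.
by apply: eC; rewrite -ball_normE /= -opprD normrN.
Qed.

End cone_calculus.

(** * Limit points of the iterates *)

Section limit_points.
Context {R : realType} {d : nat} {Y : normedModType R}.
Variables (K : set Y) (Q : set 'rV[R]_d) (g0 h0 : 'rV[R]_d -> R).
Variables (G H : 'rV[R]_d -> Y).
Hypotheses (Y_findim : finite_dimensional Y) (K_proper : proper_cone K).
Hypotheses (K_generating : generating K) (Q_closed : closed Q).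
Hypotheses (g0_convex : convex_function setT g0).
Hypotheses (h0_convex : convex_function setT h0).
Hypotheses (G_convex : K_convex K G) (H_convex : K_convex K H).
Hypothesis H_C1 : continuously_differentiable H.
(** [L] stands for the penalty parameter in force from step [N] on. *)
Variables (L : {linear Y -> R^o}) (c m : R).
Hypotheses (L_continuous : continuous L) (c_gt0 : 0 < c).
Hypothesis L_ge : forall y, K y -> c * `|y| <= L y.
Hypothesis penalty_ge : forall z, Q z -> m <= penalty_function g0 h0 G H K c z.
Variables (x v : nat -> 'rV[R]_d) (s : nat -> Y) (N : nat).
Hypothesis v_subgradient : forall n, subdifferential h0 (x n) (v n).
Hypothesis step : forall n, (N <= n)%N ->
  subproblem_optimal g0 G H K Q (x n) (v n) L (x n.+1, s n.+1).

Let a n := g0 (x n) - h0 (x n) + L (s n).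

(** By the gradient inequality [H] lies above its linearization, so a slack for the linearized
    constraint is one for the true constraint. *)
Let iterate_feasible n : (N < n)%N ->
  [/\ Q (x n), K (s n) & K (s n - (G (x n) - H (x n)))].
Proof.
case: n => [//|n] Nn; have [[/= Kl Ks Qx] _] := step Nn.
rewrite /cone_le subr0 in Ks; split=> //.
have Kg := K_convex_gradient K_proper (x n.+1) H_convex (H_C1.1 (x n)).
have := coneD K_proper Kl Kg; congr K.
rewrite /linearized_map. by set D := 'd H _ _; linear_identity R.
Qed.

(** The subgradient inequality replaces [h0 (x n.+1)] by its affine minorant at [x n]; optimality of
    the step then compares with any feasible point. *)
Let merit_step n z y : (N <= n)%N ->
  subproblem_feasible G H K Q (x n) (z, y) ->
  a n.+1 <= g0 z - dotv (v n) z + L y - h0 (x n) + dotv (v n) (x n).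
Proof.
move=> Nn zy; have := (step Nn).2 _ zy; rewrite /subproblem_objective /= /a.
have := v_subgradient n (x n.+1); rewrite dotvDr dotvNr; lra.
Qed.

Let merit_nonincreasing n : (N < n)%N -> a n.+1 <= a n.
Proof.
move=> Nn; have [Qn Kn Kl] := iterate_feasible Nn.
have := @merit_step n (x n) (s n) (ltnW Nn); rewrite /a.
suff f : subproblem_feasible G H K Q (x n) (x n, s n) by move=> /(_ f); lra.
split=> //; rewrite /cone_le ?subr0 //.
by rewrite /linearized_map /= subrr linear0 subr0.
Qed.

Let merit_ge n : (N < n)%N -> m <= a n.
Proof.
move=> Nn; have [Qn Kn Kl] := iterate_feasible Nn.
apply: le_trans (penalty_ge Qn) _; rewrite /a lerD2l.
apply: le_trans (L_ge Kn); rewrite ler_pM2l //.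
apply: le_trans (dist_opp_cone_le _ Kl) _.
by rewrite subrKC.
Qed.

Let merit_cvg : exists l : R, a @ \oo --> l.
Proof.
pose b := [sequence a (n + N.+1)%N]_n.
have : cvgn b.
  apply: nonincreasing_is_cvgn.
    by apply/nonincreasing_seqP => n; apply: merit_nonincreasing;
      rewrite leq_addl.
  by exists m => _ [n _ <-]; apply: merit_ge; rewrite leq_addl.
move=> /cvg_ex [l bl]; exists l.
by rewrite -(cvg_shiftn N.+1).
Qed.

Let g0_continuous := convex_function_continuous g0_convex.
Let h0_continuous := convex_function_continuous h0_convex.

Let G_continuous : continuous G.
Proof.
have [e Ke e_unit] := generating_cone_unit K_proper Y_findim K_generating.
exact: (K_convex_continuous K_proper G_convex Ke e_unit c_gt0 L_ge).
Qed.

Let H_continuous : continuous H.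
Proof. by move=> z; apply: differentiable_continuous; exact: H_C1.1. Qed.

Variables (U : set_system nat) (xs : 'rV[R]_d).
Hypotheses (U_ultra : UltraFilter U) (U_oo : \oo `<=` U).
Hypothesis x_cvg : x @ U --> xs.

Let eventually_gt : \forall n \near U, (N < n)%N.
Proof. by apply: U_oo; exists N.+1. Qed.

(** The subgradient inequality at [x n] plus or minus a basis vector bounds the coordinates of [v n]
    by differences of [h0], which are continuous in [x n]. *)
Let subgradients_cvg : exists vs : 'rV[R]_d, v @ U --> vs.
Proof.
pose w z := \sum_(i < d) (`|h0 (z + delta_mx 0 i) - h0 z| +
                          `|h0 (z - delta_mx 0 i) - h0 z|).
have vw n : `|v n| <= w (x n).
  apply: normr_rV_le => [|i]; first by apply: sumr_ge0 => i _; rewrite addr_ge0.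
  rewrite /w (bigD1 i) //= -[leLHS]addr0 lerD //; last first.
    by apply: sumr_ge0 => j _; rewrite addr_ge0.
  have h1 := v_subgradient n (x n + delta_mx 0 i).
  have h2 := v_subgradient n (x n - delta_mx 0 i).
  rewrite addrAC subrr add0r dotv_delta in h1.
  rewrite addrAC subrr add0r dotvNr dotv_delta in h2.
  have n1 := ler_norm (h0 (x n + delta_mx 0 i) - h0 (x n)).
  have n2 := ler_norm (h0 (x n - delta_mx 0 i) - h0 (x n)).
  have p1 := normr_ge0 (h0 (x n + delta_mx 0 i) - h0 (x n)).
  have p2 := normr_ge0 (h0 (x n - delta_mx 0 i) - h0 (x n)).
  rewrite ler_norml; apply/andP; split; lra.
have wU : w (x n) @[n --> U] --> w xs.
  apply: (cvg_big (op := +%R)) => [|i _]; first exact: add_continuous.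
  have h0x := cvg_comp x h0 x_cvg (@h0_continuous xs).
  apply: cvgD; apply: cvg_norm; apply: cvgB => //.
    apply: (cvg_comp (fun n => x n + delta_mx 0 i) h0 _ (@h0_continuous _)).
    by apply: cvgD => //; exact: cvg_cst.
  apply: (cvg_comp (fun n => x n - delta_mx 0 i) h0 _ (@h0_continuous _)).
  by apply: cvgB => //; exact: cvg_cst.
apply: (@ultra_rV_cvg _ _ _ _ _ (w xs + 1) U_ultra).
have : \forall n \near U, w (x n) <= w xs + 1.
  by apply: (cvgr_le _ wU); rewrite ltrDl.
by apply: filterS => n; exact: le_trans.
Qed.

Lemma ultrafilter_limit_optimal : exists (vs : 'rV[R]_d) (ss : Y),
  [/\ s @ U --> ss, Q xs, K ss, subdifferential h0 xs vs &
      subproblem_optimal g0 G H K Q xs vs L (xs, ss)].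
Proof.
have [l al] := merit_cvg.
have aU : a n @[n --> U] --> l by move=> A /al; exact: U_oo.
(* The whole merit sequence converges, so its shift has the same limit along [U], although [x n.+1]
   itself need not converge along [U]. *)
have aSU : a n.+1 @[n --> U] --> l.
  by have := al; rewrite -cvg_shiftS => alS A /alS; exact: U_oo.
have gU := cvg_comp x g0 x_cvg (@g0_continuous xs).
have hU := cvg_comp x h0 x_cvg (@h0_continuous xs).
have GU := cvg_comp x G x_cvg (@G_continuous xs).
have HU := cvg_comp x H x_cvg (@H_continuous xs).
have LU : L (s n) @[n --> U] --> l - (g0 xs - h0 xs).
  have -> : (fun n => L (s n) : R) = (fun n => a n - (g0 (x n) - h0 (x n))).
    by apply/funext => n; rewrite /a; ring.
  by apply: cvgB => //; exact: cvgB.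
(* [L (s n)] converges, hence is eventually bounded, and on [K] it dominates [c] times the norm. *)
have [ss sU] : exists ss : Y, s @ U --> ss.
  apply: (@finite_dimensional_ultra_cvg _ _ _ _ _
    ((l - (g0 xs - h0 xs) + 1) / c) Y_findim U_ultra).
  have : \forall n \near U, L (s n) <= l - (g0 xs - h0 xs) + 1.
    by apply: (cvgr_le _ LU); rewrite ltrDl.
  apply: filterS2 eventually_gt => n Nn Ls.
  have [_ Kn _] := iterate_feasible Nn.
  by rewrite ler_pdivlMr // mulrC; exact: le_trans (L_ge Kn) Ls.
have [vs vU] := subgradients_cvg.
have lE : l = g0 xs - h0 xs + L ss.
  suff -> : L ss = l - (g0 xs - h0 xs) by ring.
  apply: (cvg_unique _ _ LU); first exact: norm_hausdorff.
  exact: (cvg_comp s L sU (@L_continuous ss)).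
have Kss : K ss.
  apply: (closed_cvg K (cone_closed K_proper) _ _ sU).
  by apply: filterS eventually_gt => n /iterate_feasible[].
have Qxs : Q xs.
  apply: (closed_cvg Q Q_closed _ _ x_cvg).
  by apply: filterS eventually_gt => n /iterate_feasible[].
exists vs, ss; split=> //.
  move=> z; apply: (@ler_cvg_to _ U _ _
      (fun n => h0 (x n) + dotv (v n) (z - x n)) (fun=> h0 z)).
  - apply: cvgD => //; apply: cvg_dotv => //.
    by apply: cvgB => //; exact: cvg_cst.
  - exact: cvg_cst.
  - by apply: nearW => n; exact: v_subgradient.
split.
  split=> //=; last by rewrite /cone_le subr0.
  rewrite /cone_le /linearized_map subrr linear0 subr0.
  apply: (closed_cvg K (cone_closed K_proper) _ _
    (cvgB sU (cvgB GU HU))).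
  by apply: filterS eventually_gt => n /iterate_feasible[].
move=> [z y] [/= Kzy Ky Qz]; rewrite /subproblem_objective /=.
rewrite /cone_le subr0 in Ky.
have [e Ke e_unit] := generating_cone_unit K_proper Y_findim K_generating.
(* The perturbation of the linearized constraint is absorbed by a vanishing
   multiple of the order unit. *)
pose w n := linearized_map G H (x n) z - linearized_map G H xs z.
have wU : w @ U --> 0.
  rewrite -(subrr (linearized_map G H xs z)); apply: cvgB; last exact: cvg_cst.
  apply: cvgB; first by apply: cvgB => //; exact: cvg_cst.
  apply: cvg_diff_apply => //.
  by apply: cvgB => //; exact: cvg_cst.
have yU : L (y + `|w n| *: e) @[n --> U] --> L y.
  have : y + `|w n| *: e @[n --> U] --> y + `|0 : Y| *: e.
    by apply: cvgD; [exact: cvg_cst|apply: cvgZr_tmp; exact: cvg_norm].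
  rewrite normr0 scale0r addr0 => ywU.
  exact: (cvg_comp (fun n => y + `|w n| *: e) L ywU (@L_continuous _)).
(* The limit of [merit_step] for the competitor [z] with the enlarged slack. *)
have : l <= g0 z - dotv vs z + L y - h0 xs + dotv vs xs.
  apply: (@ler_cvg_to _ U _ _ (fun n => a n.+1) (fun n =>
    g0 z - dotv (v n) z + L (y + `|w n| *: e) - h0 (x n) + dotv (v n) (x n)))
      => //.
    apply: cvgD; last exact: cvg_dotv.
    apply: cvgB => //; apply: cvgD => //; apply: cvgB; first exact: cvg_cst.
    by apply: cvg_dotv => //; exact: cvg_cst.
  apply: filterS eventually_gt => n Nn; apply: merit_step; first exact: ltnW.
  split=> //=; rewrite /cone_le ?subr0.
    have := coneD K_proper Kzy (e_unit (w n)); congr K.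
    by rewrite /w; linear_identity R.
  by apply: coneD => //; apply: coneZ.
rewrite lE; lra.
Qed.

End limit_points.

(** * Penalty updates and criticality *)

(** Dual elements are bare functions; this recovers the bundled map on which the operator norm
    lemmas are stated. *)
Lemma linear_functionP (R : pzRingType) (V W : lmodType R) (f : V -> W) :
  linear f -> exists T : {linear V -> W}, f = T.
Proof.
move=> lf; pose T := GRing.isLinear.Build R V W *:%R f lf.
by exists (HB.pack_for {linear V -> W} f T).
Qed.

Lemma optimal_critical (R : realType) (d : nat) (Y : normedModType R)
    (K : set Y) (Q : set 'rV[R]_d) (g0 h0 : 'rV[R]_d -> R)
    (G H : 'rV[R]_d -> Y) (L : {linear Y -> R^o}) x v s :
  proper_cone K -> convex_set Q -> convex_function setT g0 -> K_convex K G ->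
  (forall y, K y -> y != 0 -> 0 < L y) ->
  dc_feasible G H K Q x -> subdifferential h0 x v ->
  subproblem_optimal g0 G H K Q x v L (x, s) -> critical g0 h0 G H K Q x.
Proof.
move=> K_proper Q_convex g0_convex G_convex L_pos xfeas vx [[/= _ Ks _] xopt].
rewrite /cone_le subr0 in Ks.
have KF : cone_le K (linearized_map G H x x) 0.
  by rewrite /linearized_map subrr linear0 subr0; case: xfeas.
have K0 : cone_le K 0 (0 : Y) by rewrite /cone_le subr0; exact: cone0.
(* At a feasible [x] the slack 0 is admissible, and any nonzero slack costs more because [L] is
   strictly positive. *)
have s0 : s = 0.
  apply/eqP; apply: contraT => s0; have := L_pos _ Ks s0.
  have := xopt (x, 0); rewrite /subproblem_objective /= linear0.
  have [Qx _] := xfeas => /(_ (And3 KF K0 Qx)); lra.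
split=> //; exists v; split=> //.
apply: constrained_minimizer_subdifferential => //.
(* The linearized set is convex: the linearized map is [G] minus an affine map. *)
- move=> a y z a01 [Qy Ky] [Qz Kz]; split; first exact: convex_set_segment.
  have := G_convex a y z a01; move: Ky Kz a01.
  rewrite /cone_le /linearized_map !sub0r.
  rewrite (_ : a *: y + _ - x = a *: (y - x) + (1 - a) *: (z - x)); last first.
    by linear_identity R.
  have -> : 'd H x (a *: (y - x) + (1 - a) *: (z - x)) =
      a *: 'd H x (y - x) + (1 - a) *: 'd H x (z - x).
    by rewrite linearD !linearZ.
  set Dy := 'd H x (y - x); set Dz := 'd H x (z - x) => Ky Kz /andP[a0].
  rewrite -subr_ge0 => a1 KG.
  have := coneD K_proper (coneZ K_proper a0 Ky)
    (coneD K_proper (coneZ K_proper a1 Kz) KG).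
  by congr K; set g := G (a *: y + _); linear_identity R.
- by case: xfeas.
- move=> z [Qz Kz]; have := xopt (z, 0) (And3 Kz K0 Qz).
  by rewrite /subproblem_objective /= s0 linear0 !addr0.
Qed.

(** Bernoulli's inequality, used to bound the number of penalty updates. *)
Lemma expr_ge_linear (R : realDomainType) (a : R) n :
  1 <= a -> 1 + n%:R * (a - 1) <= a ^+ n.
Proof.
move=> a1; elim: n => [|n IH]; first by rewrite mul0r addr0 expr0.
have a0 : 0 <= a by lra.
rewrite exprS -natr1; have := mulr_ge0 (ler0n R n) (sqr_ge0 (a - 1)).
by have := ler_wpM2l a0 IH; lra.
Qed.

(** The number [k n] of updates so far is nondecreasing, and bounded because each update leaves the
    norm at most [tau]; it is constant once its maximum is reached. The case [k = 0] stands apart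
    since the initial norm may exceed [tau]. *)
Lemma geometric_update_stabilizes (R : realType) (V W : normedModType R)
    (T : {linear V -> W}) (t : nat -> V -> W) (b : nat -> bool) (mu tau : R) :
  continuous T -> 0 < op_norm T -> 1 < mu -> t 0%N = T ->
  (forall n, t n.+1 = if b n && (mu * op_norm (t n) <= tau)
                      then mu *: t n else t n) ->
  exists N k, (forall n, (N <= n)%N -> t n = mu ^+ k *: (T : V -> W)) /\
    (k = 0%N \/ op_norm (mu ^+ k *: (T : V -> W)) <= tau).
Proof.
move=> cT T0 mu1 t0 tS.
have mu0 : 0 < mu by lra.
have opX k : op_norm (mu ^+ k *: (T : V -> W)) = mu ^+ k * op_norm T.
  by rewrite op_normZ ?exprn_gt0.
pose b' n := b n && (mu * op_norm (t n) <= tau).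
pose k n := (\sum_(i < n) b' i)%N.
have kS n : k n.+1 = (k n + b' n)%N by rewrite /k big_ord_recr.
have tk n : t n = mu ^+ k n *: (T : V -> W) /\
    (k n = 0%N \/ op_norm (mu ^+ k n *: (T : V -> W)) <= tau).
  elim: n => [|n [tn IH]].
    by rewrite /k big_ord0 expr0 scale1r; split; [|left].
  rewrite tS -/(b' n) kS; case: ifPn => [bn|_]; last by rewrite addn0.
  rewrite addn1 exprS -scalerA -tn; split=> //; right.
  by move: bn => /andP[_]; rewrite tn scalerA -exprS !opX exprS mulrA.
have [B kB] : exists B, forall n, (k n <= B)%N.
  (* Bernoulli turns the bound [tau / op_norm T] on [mu ^+ k n] into a bound on [k n]. *)
  pose B := Num.bound (`|tau / op_norm T| / (mu - 1)).
  exists B => n; have [_ [->//|]] := tk n; rewrite opX -ler_pdivlMr // => muk.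
  rewrite -(ler_nat R).
  have := archi_boundP (x := `|tau / op_norm T| / (mu - 1)).
  rewrite divr_ge0 //= ?subr_ge0 ?(ltW mu1) // => /(_ isT) /ltW; rewrite -/B.
  apply: le_trans; rewrite ler_pdivlMr ?subr_gt0 //.
  have := expr_ge_linear (k n) (ltW mu1); have := ler_norm (tau / op_norm T);
    lra.
have kmon n n' : (n <= n')%N -> (k n <= k n')%N.
  move=> /subnKC <-; elim: (n' - n)%N => [|j IH]; first by rewrite addn0.
  by rewrite addnS kS; apply: leq_trans IH (leq_addr _ _).
pose P j := `[< exists n, k n = j >].
have P0 : exists j, P j by exists (k 0%N); apply/asboolP; exists 0%N.
have PB j : P j -> (j <= B)%N by move=> /asboolP[n <-].
have [j /asboolP[N kN] maxj] := ex_maxnP P0 PB.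
exists N, j; split=> [n Nn|]; last by rewrite -kN; exact: (tk N).2.
rewrite (tk n).1 (_ : k n = j) //; apply/eqP;
  rewrite eqn_leq -{2}kN kmon // andbT.
by apply: maxj; apply/asboolP; exists n.
Qed.

Theorem theorem6 (R : realType) (d : nat) (Y : completeNormedModType R)
    (K : set Y) (Q : set 'rV[R]_d) (g0 h0 : 'rV[R]_d -> R)
    (G H : 'rV[R]_d -> Y) (mu tau_max kappa c : R)
    (x v : nat -> 'rV[R]_d) (s : nat -> Y) (t : nat -> Y -> R^o)
    (Y_findim : finite_dimensional Y)
    (K_proper : proper_cone K) (K_generating : generating K)
    (Q_closed : closed Q) (Q_convex : convex_set Q)
    (g0_cc : closed_convex_function g0) (h0_cc : closed_convex_function h0)
    (G_convex : K_convex K G) (H_convex : K_convex K H)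
    (H_C1 : continuously_differentiable H)
    (dca : exact_penalty_DCA g0 h0 G H K Q mu tau_max kappa x v s t)
    (c_min : let S := [set t 0%N y | y in [set y | K y /\ `|y| = 1]] in
             S c /\ lbound S c)
    (bounded_below :
      has_lbound [set penalty_function g0 h0 G H K c z | z in Q]) :
  0 < c /\
  exists t_lim : Y -> R^o,
    [/\ dual_space t_lim,
        op_norm (t n \- t_lim) @[n --> \oo] --> (0 : R),
        forall xs, cluster (x @ \oo) xs ->
          generalized_critical g0 h0 G H K Q t_lim xs &
        forall p : nat,
          op_norm (mu ^+ p *: t 0%N) <= tau_max ->
          (forall q : nat, op_norm (mu ^+ q *: t 0%N) <= tau_max -> (q <= p)%N) ->
          (forall z, Q z -> kappa < dist (G z - H z) [set - k | k in K] ->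
            ~ generalized_critical g0 h0 G H K Q (mu ^+ p *: t 0%N) z) ->
          (forall xs, cluster (x @ \oo) xs ->
            dist (G xs - H xs) [set - k | k in K] <= kappa) /\
          (kappa = 0 -> forall xs, cluster (x @ \oo) xs ->
            dc_feasible G H K Q xs /\ critical g0 h0 G H K Q xs)].
Proof.
case: dca => mu1 tau0 kappa0 _ [[[t0_linear t0_continuous] _] t0_pos]
  v_sub step update.
have [T t0T] := linear_functionP t0_linear.
rewrite t0T in t0_continuous t0_pos c_min.
have [[y0 [Ky0 y01] Ty0] c_lb] := c_min.
(* The minimum [c] is attained at [y0], a nonzero point of [K]. *)
have c_gt0 : 0 < c by rewrite -Ty0 t0_pos // -normr_eq0 y01 oner_eq0.
split=> //.
have T_ge y : K y -> c * `|y| <= T y.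
  move=> Ky; have [->|y0_neq0] := eqVneq y 0;
    first by rewrite normr0 linear0 mulr0.
  have ny : 0 < `|y| by rewrite normr_gt0.
  rewrite -ler_pdivlMr // mulrC -[_ * _]/(_ *: T y) -linearZ; apply: c_lb => /=.
  exists (`|y|^-1 *: y) => //; split; first by apply: coneZ => //;
    rewrite invr_ge0.
  by rewrite normrZ normfV normr_id mulVf ?gt_eqF.
have T_norm : 0 < op_norm T.
  have := op_norm_bound y0 t0_continuous.
  by rewrite y01 mulr1 Ty0 gtr0_norm //; exact: lt_le_trans.
have [N [k [tN kmax]]] :=
  geometric_update_stabilizes t0_continuous T_norm mu1 t0T update.
have muX n : 0 < mu ^+ n by rewrite exprn_gt0 //; lra.
pose L : {linear Y -> R^o} := mu ^+ k \*: T.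
have L_continuous : continuous L.
  by move=> y; apply: cvgZl_tmp; exact: t0_continuous.
have L_pos y : K y -> y != 0 -> 0 < L y.
  by move=> Ky y_neq0; rewrite mulr_gt0 ?t0_pos.
(* Since [mu ^+ k] is at least 1, the constant [c] of the initial parameter still serves [L]. *)
have L_ge y : K y -> c * `|y| <= L y.
  move=> Ky; apply: le_trans (T_ge _ Ky) _;
    rewrite ler_peMl ?exprn_ege1 ?(ltW mu1) //.
  by apply: le_trans (T_ge _ Ky); rewrite mulr_ge0 // ltW.
have L_dual : dual_pos K L.
  split=> //; split; first by split=> //; exact: linearP.
  by move=> y Ky; apply: le_trans (L_ge _ Ky); rewrite mulr_ge0 // ltW.
have [m m_lb] := bounded_below.
have step' n : (N <= n)%N ->
    subproblem_optimal g0 G H K Q (x n) (v n) L (x n.+1, s n.+1).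
  by move=> Nn; have := step n; rewrite tN.
have limit xs : cluster (x @ \oo) xs -> exists (U : set_system nat) vs ss,
    [/\ UltraFilter U, \oo `<=` U & s @ U --> ss] /\
    [/\ Q xs, K ss, subdifferential h0 xs vs &
        subproblem_optimal g0 G H K Q xs vs L (xs, ss)].
  move=> /cluster_ultra [U [UU Uoo xU]].
  have [vs [ss [sU Qxs Kss vsx opt]]] := ultrafilter_limit_optimal Y_findim
    K_proper K_generating Q_closed g0_cc.1 h0_cc.1 G_convex H_convex H_C1
    L_continuous c_gt0 L_ge (fun z Qz => m_lb _ (imageP _ Qz)) v_sub step'
    UU Uoo xU.
  by exists U, vs, ss.
have gen_crit xs :
    cluster (x @ \oo) xs -> generalized_critical g0 h0 G H K Q L xs.
  move=> /limit [U [vs [ss [_ [Qxs Kss vsx opt]]]]]; split=> //.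
  by exists vs, ss; split; rewrite // /cone_le subr0.
exists L; split=> //; first by split=> //; exact: linearP.
  apply: cvg_near_cst; exists N => // n /= Nn; rewrite tN //.
  apply/eqP; rewrite eq_le; apply/andP; split.
  - apply: (@op_norm_le _ _ _ (L \- L : {linear Y -> R^o})) => // y.
    by rewrite /= subrr normr0 mul0r.
  - apply: (@op_norm_ge0 _ _ _ (L \- L : {linear Y -> R^o})) => y.
    by apply: cvgB; exact: L_continuous.
move=> p; rewrite t0T => p_le p_max not_crit.
have dist_le xs : cluster (x @ \oo) xs ->
    dist (G xs - H xs) [set - k | k in K] <= kappa.
  move=> cl_xs; have [U [vs [ss [[UU Uoo sU] [Qxs _ _ [[/= Kl _ _] _]]]]]]
    := limit _ cl_xs.
  have kp : (k <= p)%N by case: kmax => [->|/p_max].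
  (* If [k = p], the limit parameter is the one that [not_crit] excludes. *)
  have [kE|k_neq] := eqVneq k p.
    by rewrite leNgt; apply/negP => /(not_crit _ Qxs); apply; rewrite -kE;
      exact: gen_crit.
  (* If [k < p], one more multiplication by [mu] still respects [tau_max], so a slack of norm at
     least [kappa] would trigger an update after step [N]. *)
  have small n : (N < n)%N -> `|s n| <= kappa.
    case: n => // n Nn; apply/ltW; rewrite ltNge; apply/negP => big.
    have := update n; rewrite !tN ?(ltnW Nn) // big /=.
    rewrite op_normZ // mulrA -exprS.
    have -> : mu ^+ k.+1 * op_norm T <= tau_max.
      apply: le_trans p_le; rewrite op_normZ // ler_pM2r //.
      by rewrite ler_weXn2l ?(ltW mu1) // ltn_neqAle k_neq.
    (* Such an update would give [L = mu *: L], which fails at [y0]. *)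
    move=> /(congr1 (fun f : Y -> R^o => f y0)) LE.
    have Ly0 : 0 < L y0 by apply: L_pos => //; rewrite -normr_eq0 y01 oner_eq0.
    have {}LE : L y0 = mu * L y0 := LE.
    nra.
  (* At [xs] the linearized constraint is the true one, so the infeasibility is at most the norm of
     [ss], a limit of norms bounded by [kappa]. *)
  rewrite /cone_le /linearized_map subrr linear0 subr0 in Kl.
  apply: le_trans (dist_opp_cone_le _ Kl) _; rewrite subrKC.
  apply: (ler_cvg_to (cvg_norm sU) (cvg_cst kappa)).
  by apply: Uoo; exists N.+1.
split=> // kappa_eq0 xs cl_xs.
have [U [vs [ss [_ [Qxs _ vsx opt]]]]] := limit _ cl_xs.
have xfeas : dc_feasible G H K Q xs.
  split=> //; rewrite /cone_le sub0r; apply: dist_opp_cone_eq0 => //.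
  by rewrite -kappa_eq0; exact: dist_le.
split=> //; exact: (optimal_critical K_proper Q_convex g0_cc.1 G_convex L_pos
  xfeas vsx opt).
Qed.
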